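(* There exist absolute constants $c_1>0$ and $c_2$ such that \[ c_1\frac{q^n}{n}\leq C(n,q)\leq c_2\frac{q^n}{n} \] for all integers $n\geq 2$ and $q\geq 2$.
   Context: Let $F$ be a finite alphabet with $|F|=q$. Two words $u,v\in F^n$ (not necessarily distinct) are overlapping if a non-empty proper prefix of $u$ equals a non-empty proper suffix of $v$, or a non-empty proper prefix of $v$ equals a non-empty proper suffix of $u$. A code $C\subseteq F^n$ is non-overlapping if for all (not necessarily distinct) $u,v\in C$, the words $u$ and $v$ are not overlapping. $C(n,q)$ denotes the maximum cardinality of a non-overlapping code $C\subseteq F^n$ with $|F|=q$. *)

(* Defs.v *)
From mathcomp Require Import all_boot.

Set Implicit Arguments.
Unset Strict Implicit.
Unset Printing Implicit Defensive.

Section NonOverlapping.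

Variables (F : finType) (n : nat).
Implicit Types (u v : n.-tuple F) (C : {set n.-tuple F}).

(* As u and v have length n, a prefix of u (or a suffix of v) is non-empty
   and proper exactly when its length k satisfies 0 < k < n; the upper bound
   is carried by k : 'I_n. *)
Definition prefix_meets_suffix u v : bool :=
  [exists k : 'I_n, exists w : k.-tuple F,
     [&& 0 < k, prefix w u & suffix w v]].

Definition overlapping u v : bool :=
  prefix_meets_suffix u v || prefix_meets_suffix v u.

(* u = v is allowed: a word of the code must not overlap itself either. *)
Definition non_overlapping C : bool :=
  [forall u in C, forall v in C, ~~ overlapping u v].

Definition max_non_overlapping : nat :=
  \max_(C : {set n.-tuple F} | non_overlapping C) #|C|.

Lemma prefix_meets_suffixP u v :
  reflect (exists w : seq F,
             [/\ w <> [::], prefix w u /\ w <> u & suffix w v /\ w <> v])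
          (prefix_meets_suffix u v).
Proof.
apply: (iffP existsP) => [[k /existsP[w /and3P[k0 pu sv]]]|].
  exists w; split.
  - by move=> w0; move: k0; rewrite -(size_tuple w) w0.
  - split=> // wu; have := ltn_ord k.
    by rewrite -(size_tuple w) wu size_tuple ltnn.
  - split=> // wv; have := ltn_ord k.
    by rewrite -(size_tuple w) wv size_tuple ltnn.
move=> [w [w0 [pu wu] [sv _]]].
have wn : size w < n.
  rewrite -(size_tuple u) ltn_neqAle size_prefix // andbT.
  apply/eqP => e; apply: wu; move: pu; rewrite prefixE e take_size => /eqP.
  by move=> <-.
exists (Ordinal wn); apply/existsP; exists (in_tuple w).
by rewrite /= pu sv !andbT lt0n size_eq0; apply/eqP.
Qed.

Lemma max_non_overlapping_attained :
  exists2 C, non_overlapping C & #|C| = max_non_overlapping.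
Proof.
have n0 : non_overlapping set0.
  by apply/forall_inP => u; rewrite inE.
have [|C nC eC] := @eq_bigmax_cond _ (mem non_overlapping)
  (fun C : {set n.-tuple F} => #|C|).
  by apply/card_gt0P; exists set0.
by exists C => //; rewrite -eC.
Qed.

End NonOverlapping.

(* C(n, q), computed over the alphabet 'I_q; by Cnq_card below the choice of
   the alphabet of size q is irrelevant. *)
Definition Cnq (n q : nat) : nat := max_non_overlapping 'I_q n.

Lemma prefix_meets_suffix_map (F G : finType) (f : F -> G) n
    (u v : n.-tuple F) :
  injective f ->
  prefix_meets_suffix (map_tuple f u) (map_tuple f v) =
  prefix_meets_suffix u v.
Proof.
move=> fI; apply: eq_existsb => k; apply/existsP/existsP.
  move=> [w /and3P[k0 pw sw]].
  have ku : size (take k u) == k.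
    by rewrite size_takel // size_tuple ltnW.
  exists (Tuple ku); move: pw sw.
  rewrite prefixE size_tuple -map_take => /eqP e; rewrite -e.
  rewrite !suffixE !size_map /= -map_drop => /eqP/(inj_map fI) ->.
  by rewrite k0 prefix_take eqxx.
move=> [w /and3P[k0 pw sw]]; exists (map_tuple f w).
move: pw sw; rewrite !prefixE !suffixE !size_map -map_take -map_drop.
by move=> /eqP -> /eqP ->; rewrite k0 !eqxx.
Qed.

Lemma leq_max_non_overlapping (F G : finType) n (f : F -> G) :
  injective f -> max_non_overlapping F n <= max_non_overlapping G n.
Proof.
move=> fI; apply/bigmax_leqP => C nC.
have mI : injective (map_tuple f : n.-tuple F -> n.-tuple G).
  by move=> u v /(congr1 val) /(inj_map fI) /val_inj.
rewrite -(card_imset _ mI); apply: (leq_bigmax_cond (F := fun C => #|_|)).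
apply/forall_inP => _ /imsetP[u uC ->]; apply/forall_inP => _ /imsetP[v vC ->].
rewrite /overlapping !prefix_meets_suffix_map //.
by move/forall_inP/(_ _ uC)/forall_inP/(_ _ vC): nC.
Qed.

Lemma Cnq_card (F : finType) n : max_non_overlapping F n = Cnq n #|F|.
Proof.
apply/eqP; rewrite eqn_leq; apply/andP; split.
- exact: leq_max_non_overlapping enum_rank_inj.
- exact: leq_max_non_overlapping enum_val_inj.
Qed.

(* Main.v *)
Require Import Defs.
From mathcomp Require Import all_boot all_order all_algebra.
From mathcomp Require Import reals zify.

Import Order.TTheory GRing.Theory Num.Theory.
Local Open Scope ring_scope.

(** Upper bound: the rotations [rot i u] of the words [u] of a non-overlapping
    code are pairwise distinct, for if [rot i u = v] with [0 < i < n], then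
    a proper suffix of [u] is a prefix of [v].  Hence [n * C(n, q) <= q ^ n].

    Lower bound: split the alphabet into two halves [A] and [~: A].  The words
    that start with [k] letters of [A], end with a letter outside [A] and have
    no other run of [k] letters of [A] form a non-overlapping code.  When
    [(#|A| / q) ^ k] is about [1 / (2 n)], the union bound shows that the
    condition on the runs in the middle discards at most half of the words, so
    that the code has about [q ^ n / n] words. *)

Section Code.
Local Open Scope nat_scope.
Variable F : finType.
Implicit Types A : {set F}.

(** * Overlaps, rotations and the upper bound *)

Lemma prefix_meets_suffix_tnth n (u v : n.-tuple F) :
  prefix_meets_suffix u v ->
  exists2 m, 0 < m < n &
    forall x y : 'I_n, y = n - m + x :> nat -> tnth u x = tnth v y.
Proof.
case/existsP => m /existsP[w /and3P[m0]].
rewrite prefixE suffixE size_tuple size_tuple => /eqP wu /eqP wv.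
exists (m : nat); first by rewrite m0 ltn_ord.
move=> x y xy; have mn := ltn_ord m; have yn := ltn_ord y.
rewrite (tnth_nth (tnth u x)) [RHS](tnth_nth (tnth u x)) xy -nth_drop wv -wu.
by rewrite nth_take //; lia.
Qed.

Lemma non_overlapping_rot_inj n (C : {set n.-tuple F}) : non_overlapping C ->
  {in [set p : n.-tuple F * 'I_n | p.1 \in C] &,
     injective (fun p : n.-tuple F * 'I_n => [tuple of rot p.2 p.1])}.
Proof.
move=> nC.
have key (u v : n.-tuple F) (i j : 'I_n) : u \in C -> v \in C -> i < j ->
    rot i u <> rot j v.
  move=> uC vC ij e.
  have: prefix_meets_suffix u v.
    have kn : n - (j - i) < n by have := ltn_ord j; lia.
    (* Undoing [rot i] shows that [u] is [rot (j - i) v], which begins with the proper suffix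
       [drop (j - i) v] of [v]. *)
    have uE : tval u = rot (j - i) v.
      apply: (@rot_inj i); rewrite e -rotD (subnKC (ltnW ij)) //.
      by rewrite size_tuple ltnW.
    have ks : size (drop (j - i) v) == n - (j - i).
      by rewrite size_drop size_tuple.
    apply/existsP; exists (Ordinal kn); apply/existsP; exists (Tuple ks).
    rewrite /= suffix_drop uE prefix_prefix !andbT.
    by have := ltn_ord j; lia.
  move/forall_inP/(_ _ uC)/forall_inP/(_ _ vC): nC.
  by rewrite /overlapping => /norP[/negP].
move=> [u i] [v j]; rewrite !inE /= => uC vC /(congr1 val) /= e.
case: (ltngtP i j) => [ij|ji|/val_inj ij].
- by case: (key _ _ _ _ uC vC ij).
- by case: (key _ _ _ _ vC uC ji).
- by rewrite ij in e *; rewrite (val_inj (rot_inj e)).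
Qed.

Lemma max_non_overlapping_upper n : n * max_non_overlapping F n <= #|F| ^ n.
Proof.
have [C nC <-] := max_non_overlapping_attained F n.
have := max_card [set [tuple of rot p.2 p.1] | p : n.-tuple F * 'I_n
  in [set p : n.-tuple F * 'I_n | p.1 \in C]].
rewrite (card_in_imset (non_overlapping_rot_inj _ _ nC)) card_tuple.
apply: leq_trans; rewrite mulnC -[X in _ * X]card_ord -cardX.
by apply/subset_leq_card/subsetP => p; rewrite !inE => /andP[].
Qed.

(** * Words with one constraint per position *)

(** [P] is indexed by [nat] so that the product counting a box can be split at any position. *)
Definition box n (P : nat -> {set F}) : {set n.-tuple F} :=
  [set w | [forall x : 'I_n, tnth w x \in P x]].

Lemma card_box n P : #|box n P| = \prod_(0 <= x < n) #|P x|.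
Proof.
rewrite big_mkord.
pose t (f : {ffun 'I_n -> F}) := [tuple f x | x < n].
have tI : injective t.
  move=> f g e; apply/ffunP => x.
  by have := congr1 (fun w : n.-tuple F => tnth w x) e; rewrite !tnth_mktuple.
have -> : box n P = t @: family (fun x : 'I_n => mem (P x)).
  apply/setP => w; rewrite inE; apply/forallP/imsetP => [wP|[f /familyP fP ->]].
    exists [ffun x => tnth w x].
      by apply/familyP => x; rewrite ffunE; exact: wP.
    by apply: eq_from_tnth => x; rewrite tnth_mktuple ffunE.
  by move=> x; rewrite tnth_mktuple; exact: fP.
rewrite card_imset // card_family foldrE big_map big_enum.
by apply: eq_bigr.
Qed.

(** * The code given by runs of letters *)

Definition run_code A n k : {set n.-tuple F} :=
  [set w | [&& [forall x : 'I_n, (x < k) ==> (tnth w x \in A)],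
               [forall x : 'I_n, (x == n.-1 :> nat) ==> (tnth w x \notin A)] &
               [forall s : 'I_n, (0 < s) && (s + k <= n) ==>
                  [exists x : 'I_n, (s <= x < s + k) && (tnth w x \notin A)]]]].

(** If the overlap has length [m <= k], the last letter of [v] falls in the opening run of [u]. If
    [m > k], that run reappears in [v] at position [n - m > 0]. Both are forbidden. *)
Lemma run_code_non_overlapping A n k : non_overlapping (run_code A n k).
Proof.
suff key u v : u \in run_code A n k -> v \in run_code A n k ->
    ~~ prefix_meets_suffix u v.
  by apply/forall_inP => u uC; apply/forall_inP => v vC; rewrite negb_or !key.
rewrite !inE => /and3P[/forallP uA _ _] /and3P[_ /forallP vN /forallP vR].
apply/negP => /prefix_meets_suffix_tnth [m /andP[m0 mn] e].
have [mk|km] := leqP m k.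
  have xn : m.-1 < n by lia.
  have yn : n.-1 < n by lia.
  have := e (Ordinal xn) (Ordinal yn) => /(_ _)/=.
  have /implyP/= /(_ _) ux := uA (Ordinal xn).
  have /implyP/= /(_ (eqxx _)) := vN (Ordinal yn).
  move=> /negP vy e'; apply: vy; rewrite -e'; [apply: ux|]; lia.
have sn : n - m < n by lia.
have /implyP/= /(_ _) := vR (Ordinal sn).
case/(_ _)/existsP; first lia.
move=> y /andP[/andP[sy ys]] /negP; apply.
have xn : y - (n - m) < n by have := ltn_ord y; lia.
rewrite -(e (Ordinal xn) y) /=; last lia.
by have /implyP := uA (Ordinal xn); apply => /=; lia.
Qed.

Lemma leq_run_code A n k : #|run_code A n k| <= max_non_overlapping F n.
Proof.
exact: (leq_bigmax_cond (F := fun C : {set n.-tuple F} => #|C|))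
  (run_code_non_overlapping A n k).
Qed.

(** The only later window that can fit starts at 1 and contains the last letter, which is outside
    [A]. This serves the small lengths. *)
Lemma run_code_short A n : #|A| ^ n * #|~: A| <= #|run_code A n.+1 n|.
Proof.
pose P x := if x < n then A else ~: A.
have -> : #|A| ^ n * #|~: A| = #|box n.+1 P|.
  rewrite card_box big_nat_recr //= {2}/P ltnn; congr (_ * _).
  rewrite (eq_big_nat _ _ (F2 := fun=> #|A|)) ?prod_nat_const_nat ?subn0 //.
  by move=> x /andP[_ xn]; rewrite /P xn.
apply/subset_leq_card/subsetP => w; rewrite !inE => /forallP wP.
have wN : tnth w ord_max \notin A.
  by have := wP ord_max; rewrite /P ltnn inE.
apply/and3P; split.
- by apply/forallP => x; apply/implyP => xn; have := wP x; rewrite /P xn.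
- by apply/forallP => x; apply/implyP => /= xn; rewrite (_ : x = ord_max) //;
    apply/val_inj/eqP.
- apply/forallP => s; apply/implyP => sP; apply/existsP; exists ord_max.
  by rewrite wN andbT /=; have := ltn_ord s; lia.
Qed.

(** * Union bound over later runs *)

(** The letters outside [A] at [k] and [n.-1] rule out runs starting at [s] with [0 < s <= k] or
    [s + k = n]; any other later run occupies unconstrained positions only. *)
Definition frame A n k x : {set F} :=
  if x < k then A else if (x == k) || (x == n.-1) then ~: A else setT.

Definition frame_run A n k s x : {set F} :=
  if s <= x < s + k then A else frame A n k x.

Lemma card_frame A n k : k.+2 <= n ->
  #|box n (frame A n k)| = #|A| ^ k * #|~: A| ^ 2 * #|F| ^ (n - k.+2).
Proof.
case: n => // n kn; rewrite card_box.
rewrite (@big_cat_nat _ _ _ k) //=; last lia.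
rewrite [X in _ * X]big_ltn; last lia.
rewrite big_nat_recr /=; last lia.
rewrite (eq_big_nat _ _ (m := 0) (n := k) (F2 := fun=> #|A|)); last first.
  by move=> x /andP[_ xk]; rewrite /frame xk.
rewrite (eq_big_nat _ _ (m := k.+1) (n := n) (F2 := fun=> #|F|)); last first.
  move=> x xP; rewrite /frame ifN ?ifN ?cardsT //; lia.
rewrite !prod_nat_const_nat /frame ltnn eqxx ifN ?eqxx ?orbT; last lia.
rewrite subn0 (_ : n.+1 - k.+2 = n - k.+1) //.
by rewrite /=; lia.
Qed.

(** Forcing a run on [k] unconstrained positions turns [k] factors [#|F|] into [#|A|]; the ratio is
    stated without division. *)
Lemma card_frame_run A n k s : k < s -> s + k < n ->
  #|box n (frame_run A n k s)| * #|F| ^ k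
  = #|box n (frame A n k)| * #|A| ^ k.
Proof.
move=> ks skn; rewrite !card_box.
rewrite (@big_cat_nat _ _ _ s) //=; last lia.
rewrite (@big_cat_nat _ _ _ (s + k) s) //=; [|lia|lia].
rewrite [in RHS](@big_cat_nat _ _ _ s) //=; last lia.
rewrite [in RHS](@big_cat_nat _ _ _ (s + k) s) //=; [|lia|lia].
rewrite (eq_big_nat _ _ (m := 0) (n := s)
  (F2 := fun x => #|frame A n k x|)); last first.
  by move=> x xs; rewrite /frame_run ifN //; lia.
rewrite (eq_big_nat _ _ (m := s + k) (n := n)
  (F2 := fun x => #|frame A n k x|)); last first.
  by move=> x xs; rewrite /frame_run ifN //; lia.
rewrite (eq_big_nat _ _ (m := s) (n := s + k) (F2 := fun=> #|A|)); last first.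
  by move=> x xs; rewrite /frame_run ifT.
rewrite (eq_big_nat _ _ (m := s) (n := s + k) (F1 := fun x => #|frame A n k x|)
  (F2 := fun=> #|F|)); last first.
  by move=> x xs; rewrite /frame ifN ?ifN ?cardsT //; lia.
rewrite !prod_nat_const_nat addKn -!mulnA; congr (_ * _).
by rewrite mulnC -mulnA mulnCA.
Qed.

Lemma frame_sub A n k : k.+2 <= n ->
  box n (frame A n k) \subset run_code A n k :|:
    \bigcup_(s < n | k < s < n - k) box n (frame_run A n k s).
Proof.
move=> kn; apply/subsetP => w wP; rewrite inE orbC.
apply/orP; case: (boolP (w \in run_code A n k)) => [|wC]; [by right | left].
have {}wP x : tnth w x \in frame A n k x by move: wP; rewrite inE => /forallP.
move: wC; rewrite inE !negb_and.
move=> /or3P[] /forallPn[s]; rewrite negb_imply => /andP[sP].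
- by have := wP s; rewrite /frame sP => ->.
- by have := wP s; rewrite /frame sP orbT ifN ?inE => [->|]; lia.
rewrite negb_exists => /forallP sA.
have wA (x : 'I_n) : s <= x < s + k -> tnth w x \in A.
  by move=> xP; have := sA x; rewrite xP negbK.
have ks : k < s.
  rewrite ltnNge; apply/negP => sk.
  have kn' : k < n by lia.
  have := wP (Ordinal kn'); rewrite /frame ltnn eqxx inE wA //=; lia.
have skn : s < n - k.
  rewrite ltnNge; apply/negP => sk.
  have kn' : n.-1 < n by lia.
  have := wP (Ordinal kn'); rewrite /frame /= eqxx orbT ifN; last lia.
  by rewrite inE wA //=; have := ltn_ord s; lia.
apply/bigcupP; exists s; first by rewrite ks.
rewrite inE; apply/forallP => x; rewrite /frame_run.
by case: ifP => [|_]; [exact: wA | exact: wP].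
Qed.

Lemma leq_card_bigcup (I T : finType) (P : pred I) (B : I -> {set T}) :
  #|\bigcup_(i | P i) B i| <= \sum_(i | P i) #|B i|.
Proof.
elim/big_rec2: _ => [|i m U _ le_Um]; first by rewrite cards0.
by rewrite (leq_trans (leq_card_setU _ _)) // leq_add2l.
Qed.

(** There are at most [n] windows, each a run in a share [(#|A| / #|F|) ^ k <= 1 / (2 n)] of the
    frame words, so at most half of these are lost. *)
Lemma run_code_lower A n k : k.+2 <= n -> 2 * n * #|A| ^ k <= #|F| ^ k ->
  #|box n (frame A n k)| <= 2 * #|run_code A n k|.
Proof.
move=> kn nA.
(* [#|F| ^ k] is cancelled below; if it vanishes, [F] is empty and there are no words. *)
have [F0|F0] := posnP (#|F| ^ k).
  move/eqP: F0; rewrite expn_eq0 => /andP[/eqP F00 _].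
  rewrite (leq_trans (max_card _)) // card_tuple F00 exp0n //; lia.
have := leq_trans (subset_leq_card (frame_sub A n k kn)) (leq_card_setU _ _).
set N := #|box _ _|; set U := \bigcup_(_ < _ | _) _; set M := #|run_code _ _ _|.
suff UN : 2 * #|U| <= N by lia.
rewrite -(leq_pmul2r F0).
apply: (@leq_trans (2 * \sum_(s < n) N * #|A| ^ k)).
  rewrite -mulnA leq_mul2l /=.
  apply: (@leq_trans (\sum_(s < n | k < s < n - k) N * #|A| ^ k)); last first.
    by rewrite [leqRHS](bigID (fun s : 'I_n => k < s < n - k)) leq_addr.
  apply: leq_trans (leq_mul (leq_card_bigcup _ _ _ _) (leqnn _)) _.
  rewrite big_distrl /=; apply: leq_sum => s sP.
  by rewrite card_frame_run //; lia.
rewrite sum_nat_const card_ord.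
by rewrite (_ : _ * _ = N * (2 * n * #|A| ^ k)) ?leq_mul2l ?nA ?orbT //; lia.
Qed.

(** * Choice of the run length *)

(** The constant [162 = 2 * 3 ^ 4] comes from lengths below 6; the longer ones give
    [48 = 2 * 6 * 4]. *)
Lemma max_non_overlapping_lower n : 2 <= n -> 2 <= #|F| ->
  #|F| ^ n <= 162 * n * max_non_overlapping F n.
Proof.
move=> n2 q2.
have [A Ai] : exists A : {set F}, #|A| = #|F|./2.
  have /card_gt0P[A] : 0 < #|[set A : {set F} | #|A| == #|F|./2]|.
    by rewrite card_draws bin_gt0; lia.
  by rewrite inE => /eqP; exists A.
have AJ : #|A| + #|~: A| = #|F| by rewrite cardsC.
set i := #|A| in Ai AJ *; set j := #|~: A| in AJ *; set q := #|F| in q2 Ai AJ *.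
(* The worst case is [q = 3], [i = 1]. *)
have qi : q <= 3 * i by lia.
have qj : q <= 2 * j by lia.
(* From 6 on, [2 * n <= 2 ^ (n - 2)], which makes the run length [n - 2] admissible. *)
have [n6|n6] := ltnP n 6.
  case: n n2 n6 => // n n2 n6.
  have := leq_trans (run_code_short A n) (leq_run_code A n.+1 n).
  rewrite -/i -/j => h.
  have q1 : q ^ n.+1 <= 3 ^ n * 2 * (i ^ n * j).
    have qn : q ^ n <= (3 * i) ^ n by case: (n) => // m; rewrite leq_exp2r.
    rewrite expnSr (leq_trans (leq_mul qn qj)) // expnMn; lia.
  have n3 : 3 ^ n <= 81 by rewrite (@leq_pexp2l 3 _ 4).
  by rewrite (leq_trans q1) // leq_mul //; lia.
have kP : 2 * n * i ^ (n - 2) <= q ^ (n - 2).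
  apply: (@leq_trans ((2 * i) ^ (n - 2))); last by rewrite leq_exp2r; lia.
  rewrite expnMn leq_mul // (_ : n - 2 = n - 6 + 4); last lia.
  by rewrite expnD; have := ltn_expl (n - 6) (ltnSn 1); lia.
have kE : exists k, 2 * n * i ^ k <= q ^ k by exists (n - 2).
(* The least admissible run length, now written [k.+1], is at most [n - 2]; failure at [k] keeps
   [(i / q) ^ k.+1] at least [1 / (6 n)]. *)
case: (ex_minnP kE) => [[|k]] kP' kmin; first by lia.
have kn : k.+3 <= n by have := kmin _ kP; lia.
have qk : q ^ k < 2 * n * i ^ k.
  by rewrite ltnNge; apply/negP => /kmin; rewrite ltnn.
have qk1 : q ^ k.+1 <= 6 * n * i ^ k.+1.
  rewrite !expnSr (leq_trans (leq_mul (ltnW qk) qi)) //; lia.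
have := leq_trans (run_code_lower A n k.+1 kn kP')
  (leq_mul (leqnn 2) (leq_run_code A n k.+1)).
rewrite card_frame // -/i -/j -/q; set M := max_non_overlapping _ _ => NM.
have q2j : q ^ 2 <= 4 * j ^ 2 by rewrite (_ : 4 = 2 ^ 2) // -expnMn leq_exp2r.
have -> : q ^ n = q ^ k.+1 * q ^ 2 * q ^ (n - k.+3).
  by rewrite -!expnD; congr (_ ^ _); lia.
rewrite (leq_trans (leq_mul (leq_mul qk1 q2j) (leqnn _))) //.
apply: (@leq_trans (24 * n * (i ^ k.+1 * j ^ 2 * q ^ (n - k.+3)))); first lia.
by rewrite (leq_trans (leq_mul (leqnn (24 * n)) NM)) // mulnA leq_mul2r; lia.
Qed.

End Code.

(** * Both bounds over the reals *)

Theorem theorem10 (R : realType) :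
  exists c1 c2 : R, 0 < c1 /\
    forall n q : nat, (2 <= n)%N -> (2 <= q)%N ->
      c1 * (q%:R ^+ n / n%:R) <= (Cnq n q)%:R /\
      (Cnq n q)%:R <= c2 * (q%:R ^+ n / n%:R).
Proof.
exists (162%:R^-1), 1; split; first by rewrite invr_gt0 ltr0n.
move=> n q n2 q2.
have n0 : (0 : R) < n%:R by rewrite ltr0n; lia.
have := max_non_overlapping_upper 'I_q n.
have := max_non_overlapping_lower 'I_q n n2.
rewrite card_ord -/(Cnq n q) => /(_ q2) lo up; split.
  rewrite mulrA ler_pdivrMr // mulrC ler_pdivrMr ?ltr0n // -natrX -!natrM.
  by rewrite ler_nat; lia.
by rewrite mul1r ler_pdivlMr // -natrX -natrM ler_nat mulnC.
Qed.
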